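(* Let $A, B$ be closed linear operators in a complex Hilbert space $\mathbb{H}$, let $n$ be a non-negative integer, and let $\epsilon> 0$. If $B(\lambda B-A)^{-1}$ is bounded for every $\lambda\in \rho(A,B)$, then (i) $\Lambda_{n,\epsilon}(A,B)$ is a closed subset of $\mathbb{C}$; (ii) any bounded (connected) component of $\Lambda_{n,\epsilon}(A,B)$ has non-empty intersection with $\sigma(A,B)$.
   Context: For closed (possibly unbounded) operators $A,B$ in a complex Hilbert space $\mathbb{H}$ and $\lambda\in\mathbb{C}$, the pencil $\lambda B-A$ is defined on $D(A)\cap D(B)$. The generalized resolvent set is $\rho(A,B)=\{\lambda\in\mathbb{C}: (\lambda B-A)^{-1}\in\mathcal{B}(\mathbb{H})\}$, where $\mathcal{B}(\mathbb{H})$ is the set of bounded linear operators on $\mathbb{H}$, and $\sigma(A,B)=\mathbb{C}\setminus\rho(A,B)$. The $(n,\epsilon)$-pseudospectrum is $$\Lambda_{n,\epsilon}(A,B)=\sigma(A,B)\cup\left\{\lambda\in\mathbb{C}: \left\|(\lambda B-A)^{-2^n}\right\|^{1/2^n}\ge \epsilon^{-1}\right\}.$$ *)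

(* Defs.v *)
From mathcomp Require Import all_boot all_order all_algebra.
From mathcomp Require Import all_classical all_reals all_analysis.
From mathcomp Require Export complex.

Set Implicit Arguments.
Unset Strict Implicit.
Unset Printing Implicit Defensive.

Import Order.TTheory GRing.Theory Num.Theory.
Import numFieldNormedType.Exports.

Local Open Scope classical_set_scope.
Local Open Scope ring_scope.
Local Open Scope complex_scope.

Section Operators.
Context {R : realType} {H : normedModType R[i]}.

(* A possibly unbounded linear operator in H. The values of [opfun] outside of
   [dom] are irrelevant. The domain need not be dense. *)
Record linear_operator := LinearOperator {
  dom : set H;
  opfun :> H -> H;
  dom0 : dom 0;
  dom_linear : forall (a : R[i]) x y, dom x -> dom y -> dom (a *: x + y);
  opfun_linear : forall (a : R[i]) x y, dom x -> dom y ->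
    opfun (a *: x + y) = a *: opfun x + opfun y }.

Definition operator_graph (T : linear_operator) : set (H * H) :=
  [set xy | dom T xy.1 /\ xy.2 = T xy.1].

Definition closed_operator (T : linear_operator) : Prop :=
  closed (operator_graph T).

Definition bounded_operator (S : H -> H) : Prop :=
  exists M : R, forall x, `|S x| <= M%:C * `|x|.

Definition bounded_linear_operator (S : H -> H) : Prop :=
  linear S /\ bounded_operator S.

(* The norm of H takes its values in the nonnegative real elements of R[i]. *)
Definition opnorm (S : H -> H) : R :=
  sup [set complex.Re `|S x| | x in [set x : H | `|x| <= 1]].

Definition pencil_dom (A B : linear_operator) : set H := dom A `&` dom B.

Definition pencil (A B : linear_operator) (lambda : R[i]) (x : H) : H :=
  lambda *: B x - A x.

(* The inverse of the restriction of the pencil to [pencil_dom A B]; only used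
   when this restriction is a bijection onto H. *)
Definition pencil_inv (A B : linear_operator) (lambda : R[i]) : H -> H :=
  'pinv_(fun=> 0) (pencil_dom A B) (pencil A B lambda).

(* R[i]^o is R[i] with the topology of the modulus; the concrete type R[i]
   carries no topology by itself. *)
Definition resolvent_set (A B : linear_operator) : set R[i]^o :=
  [set lambda : R[i]^o | set_bij (pencil_dom A B) [set: H] (pencil A B lambda) /\
                bounded_linear_operator (pencil_inv A B lambda)].

Definition spectrum (A B : linear_operator) : set R[i]^o :=
  ~` resolvent_set A B.

Definition pseudospectrum (n : nat) (eps : R) (A B : linear_operator) :
    set R[i]^o :=
  spectrum A B `|`
  [set lambda : R[i]^o | eps^-1 <=
    opnorm (iter (2 ^ n)%N (pencil_inv A B lambda)) `^ ((2 ^ n)%N%:R)^-1].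

End Operators.

Arguments linear_operator {R} H.

(* Main.v *)
Require Import Defs.
From mathcomp Require Import all_boot all_order all_algebra.
From mathcomp Require Import all_classical all_reals all_analysis.
From mathcomp Require Import ring lra.
Import numFieldNormedType.Exports.
Local Open Scope classical_set_scope.
Local Open Scope ring_scope.
Local Open Scope complex_scope.

Set Implicit Arguments.
Unset Strict Implicit.
Unset Printing Implicit Defensive.

Import Order.TTheory GRing.Theory Num.Theory.

(** For [l] in the resolvent set write [R(l)] for the inverse of [l B - A] and
    [f(l)] for the norm of the power [R(l) ^ (2 ^ n)].

    Since [B R(l)] is bounded, [(l + z) B - A = (1 + z B R(l)) (l B - A)] is
    invertible for small [z], by a Neumann argument. So the resolvent set is
    open, [R] is bounded near [l], and the resolvent equation
    [R(l + z) = R(l) - z R(l + z) B R(l)] yields by iteration Taylor expansions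
    of [R], hence of its powers, of any length in [z] (lemmas
    [resolvent_perturbation], [resolvent_equation], [resolvent_expandable]).
    Consequently [f] is continuous, and the pseudospectrum, whose complement
    is the set of resolvent points where [f < eps^-1 ^ (2 ^ n)], is closed.

    The second assertion is a maximum principle. An expansion of length 3,
    averaged over [l + r], [l - r], [l + i r], [l - i r], loses its terms of
    degree 1 and 2, so [f(l)] is at most the mean of [f] over these points plus
    [O(r ^ 3)] (lemma [opnorm_cross_submean]). Such functions take their maximum
    over a compact set on its boundary, as one sees by adding a small multiple
    of the squared modulus, whose mean exceeds its central value by [r ^ 2]
    (lemma [maximum_principle]). Now let a bounded component [C] of the
    pseudospectrum avoid the spectrum. Components of compact sets have
    arbitrarily small relatively clopen neighbourhoods (lemma
    [component_clopen_nbhs]), so [C] has a compact neighbourhood inside the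
    resolvent set whose boundary does not meet the pseudospectrum. On that
    boundary [f < eps^-1 ^ (2 ^ n)], while [f] is at least this value on [C],
    which is absurd. *)

(** * Components of compact sets *)

Section Components.
Context {T : topologicalType}.
Implicit Types (K N A W : set T) (x : T).

Lemma closed_sub_open_shrink (L A W : set T) :
  hausdorff_space T -> compact L -> closed A -> A `<=` L° ->
  open W -> A `<=` W ->
  exists U, [/\ open U, A `<=` U & closure U `<=` W].
Proof.
move=> hT cL clA AL oW AW.
have nA := compact_normal_local hT cL AL clA.
have [|U /set_nbhsP[C [oC AC CU]] UW] := nA W.
  by apply/set_nbhsP; exists W; split.
exists C; split => //; exact: (subset_trans (closureS CU)).
Qed.

(** The clopen subsets of the subspace [K], when [K] is closed. *)
Definition clopen_part K N := [/\ closed N, closed (K `\` N) & N `<=` K].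

Definition quasicomponent K x :=
  [set y | forall N, clopen_part K N -> N x -> N y].

Lemma clopen_partT K : closed K -> clopen_part K K.
Proof. by move=> clK; split => //; rewrite setDv; exact: closed0. Qed.

Lemma clopen_partI K N1 N2 :
  clopen_part K N1 -> clopen_part K N2 -> clopen_part K (N1 `&` N2).
Proof.
move=> [c1 d1 s1] [c2 d2 s2]; split; first exact: closedI.
  by rewrite setDIr; exact: closedU.
by move=> y [/s1].
Qed.

Lemma quasicomponent_sub K x : closed K -> K x -> quasicomponent K x `<=` K.
Proof. by move=> clK Kx y /(_ K (clopen_partT clK) Kx). Qed.

Lemma quasicomponent_closed K x : closed K -> closed (quasicomponent K x).
Proof.
move=> clK.
rewrite (_ : quasicomponent K x =
  \bigcap_(N in [set N | clopen_part K N /\ N x]) N); last first.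
  apply/seteqP; split => [y qy N [cN Nx]|y qy N cN Nx]; first exact: qy.
  by apply: qy.
by apply: closed_bigI => N [[clN _ _] _].
Qed.

(** Otherwise the traces on the complement of [W] of the clopen parts through
    [x] are nonempty and form a filter base of compact sets, and a cluster
    point of it belongs to the quasicomponent but not to [W]. *)
Lemma quasicomponent_clopen_nbhs K x W : compact K -> closed K -> K x ->
  open W -> quasicomponent K x `<=` W ->
  exists N, [/\ clopen_part K N, N x & N `<=` W].
Proof.
move=> cK clK Kx oW qW; apply: contrapT => noN.
pose F := filter_from [set N | clopen_part K N /\ N x] (fun N => N `\` W).
have FF : ProperFilter F.
  apply: filter_from_proper.
    apply: filter_from_filter.
      by exists K; split => //; exact: clopen_partT.
    move=> N1 N2 [c1 x1] [c2 x2]; exists (N1 `&` N2).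
      by split => //; exact: clopen_partI.
    by move=> y [[N1y N2y] nWy].
  move=> N [cN Nx]; apply/set0P/negP => /eqP N0; apply: noN; exists N.
  by split => //; rewrite -setD_eq0.
have FK : F K.
  by exists K => [|y [] //]; split => //; exact: clopen_partT.
have [p [Kp clp]] := cK F FF FK.
have inFp N : clopen_part K N -> N x -> (N `\` W) p.
  move=> cN Nx; have clNW : closed (N `\` W).
    by rewrite setDE; apply: closedI; [case: cN | exact: open_closedC].
  rewrite ((closure_id _).1 clNW) => B Bp; apply: clp => //.
  by exists N.
by have [_] := inFp _ (clopen_partT clK) Kx; apply; apply: qW => N cN Nx;
  have [] := inFp N cN Nx.
Qed.

(** The two pieces of a separation would be closed, hence would have disjoint
    neighbourhoods [U] and [~` closure U]. A clopen part [N] of [K] inside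
    their union is cut by [U] into two clopen parts, and the one containing [x]
    contains the quasicomponent, although it misses the other piece. *)
Lemma quasicomponent_connected (L K : set T) x :
  hausdorff_space T -> compact L -> closed K -> K `<=` L° -> K x ->
  connected (quasicomponent K x).
Proof.
move=> hT cL clK KL Kx.
have cK : compact K.
  apply: (subclosed_compact clK cL).
  by apply: subset_trans KL _; exact: interior_subset.
have clQ := @quasicomponent_closed K x clK.
have QK := quasicomponent_sub clK Kx.
set Q := quasicomponent K x in clQ QK *.
apply/connectedP => E [E0 QE sE].
wlog Ex : E E0 QE sE / E false x.
  move=> wh; have : Q x by move=> N _.
  rewrite QE => -[Efx|Etx]; first exact: (wh E).
  apply: (wh (E \o negb)) => //=.
    by rewrite setUC.
  by rewrite separatedC.
have EQ b : E b `<=` Q by rewrite QE; case: b; [right|left].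
have clE b : closed (E b).
  rewrite closure_id; apply/seteqP; split; first exact: subset_closure.
  move=> y cEy; have : Q y.
    by rewrite ((closure_id Q).1 clQ); apply: closureS cEy; exact: EQ.
  case: sE => sft stf; rewrite QE; case: b cEy => cEy [] // Ey; exfalso.
    by have : (E false `&` closure (E true)) y by []; rewrite stf.
  by have : (closure (E false) `&` E true) y by []; rewrite sft.
have EL b : E b `<=` L° by apply: subset_trans (EQ b) (subset_trans QK KL).
have dE : E false `<=` ~` E true.
  exact/disjoints_subset/separated_disjoint.
have [U [oU EU UE]] :=
  closed_sub_open_shrink hT cL (clE false) (EL false)
    (closed_openC (clE true)) dE.
have QUU : Q `<=` U `|` ~` closure U.
  rewrite QE => y [Ey|Ey]; [left; exact: EU | right => /UE; exact].
have oUU : open (U `|` ~` closure U).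
  by apply: openU => //; exact/closed_openC/closed_closure.
have [N [[clN clKN NK] Nx NU]] := quasicomponent_clopen_nbhs cK clK Kx oUU QUU.
(* [N] avoids the boundary of [U], so [U] traces a clopen set on it *)
have NUcl : N `&` U = N `&` closure U.
  apply/seteqP; split => y [Ny]; first by move=> /subset_closure.
  by move=> cUy; split => //; case: (NU _ Ny).
have cNU : clopen_part K (N `&` U); first split.
- by rewrite NUcl; apply: closedI => //; exact: closed_closure.
- rewrite setDIr; apply: closedU => //.
  by rewrite setDE; apply: closedI => //; exact: open_closedC.
- by move=> y [/NK].
have [y Ey] := E0 true.
have [_ Uy] : (N `&` U) y.
  by apply: (EQ true y Ey) => //; split => //; exact: EU.
by have /UE := subset_closure Uy.
Qed.

(** In a compact set the component of a point is its quasicomponent, hence it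
    has arbitrarily small clopen neighbourhoods. *)
Lemma component_clopen_nbhs (L K W : set T) x :
  hausdorff_space T -> compact L -> closed K -> K `<=` L° -> K x ->
  open W -> connected_component K x `<=` W ->
  exists N, [/\ clopen_part K N, N x & N `<=` W].
Proof.
move=> hT cL clK KL Kx oW CW; apply: quasicomponent_clopen_nbhs => //.
  apply: (subclosed_compact clK cL).
  by apply: subset_trans KL _; exact: interior_subset.
apply: subset_trans CW; apply: connected_component_max.
- by move=> N _.
- exact: quasicomponent_sub.
- exact: (quasicomponent_connected hT cL clK KL Kx).
Qed.

End Components.

(** * Real-valued norms and the plane *)

Section RealNorm.
Context {R : realType} {V : normedModType R[i]}.
Implicit Types (x y : V).

(** Norms take their values in the real elements of [R[i]]; their real part is
    the same number seen in the ordered field [R], where suprema and linear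
    arithmetic are available. *)
Definition rnorm x : R := complex.Re `|x|.

Lemma rnormE x : `|x| = (rnorm x)%:C.
Proof. by rewrite RRe_real// ger0_real. Qed.

Lemma rnorm_ge0 x : 0 <= rnorm x.
Proof. by rewrite -ler0c -rnormE. Qed.

Lemma ler_rnormD x y : rnorm (x + y) <= rnorm x + rnorm y.
Proof. by rewrite -lecR rmorphD/= -!rnormE ler_normD. Qed.

Lemma rnormN x : rnorm (- x) = rnorm x.
Proof. by rewrite /rnorm normrN. Qed.

Lemma rnormBC x y : rnorm (x - y) = rnorm (y - x).
Proof. by rewrite /rnorm distrC. Qed.

Lemma ler_rnormB x y : rnorm (x - y) <= rnorm x + rnorm y.
Proof. by rewrite -(rnormN y) ler_rnormD. Qed.

Lemma rnorm0 : rnorm 0 = 0.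
Proof. by rewrite /rnorm normr0. Qed.

Lemma rnorm0_eq0 x : rnorm x = 0 -> x = 0.
Proof. by move=> x0; apply/eqP; rewrite -normr_eq0 rnormE x0. Qed.

Lemma nbhs_rnormP x (P : set V) :
  nbhs x P <-> exists2 d : R, 0 < d & forall y, rnorm (y - x) < d -> P y.
Proof.
split=> [/nbhs_ballP[/= e e0 eP]|[d d0 dP]].
  have eR : e = (complex.Re e)%:C by rewrite RRe_real// gtr0_real.
  exists (complex.Re e); first by rewrite -ltcR -eR.
  move=> y yx; apply: eP; rewrite -ball_normE/= distrC rnormE eR.
  by rewrite ltcR.
apply/nbhs_ballP; exists d%:C => /=; first by rewrite ltcR.
by move=> y; rewrite -ball_normE/= distrC rnormE ltcR => /dP.
Qed.

Lemma continuous_rnormP (f : V -> R) x : {for x, continuous f} <->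
  forall e, 0 < e -> exists2 d : R, 0 < d &
    forall y, rnorm (y - x) < d -> `|f x - f y| < e.
Proof.
split=> [/cvgrPdist_lt fx e /fx/nbhs_rnormP//|fx].
by apply/cvgrPdist_lt => e /fx ?; apply/nbhs_rnormP.
Qed.

Lemma rnorm_continuous : continuous rnorm.
Proof.
move=> z; apply/continuous_rnormP => e e0; exists e => // w wz.
apply: le_lt_trans wz.
have h1 := ler_rnormD (z - w) w; have h2 := ler_rnormD (w - z) z.
rewrite !subrK (rnormBC z) in h1 h2.
by rewrite ler_norml; apply/andP; split; lra.
Qed.

End RealNorm.

Section RealNormScale.
Context {R : realType} {V : normedModType R[i]}.

Lemma rnormZ (a : R[i]^o) (x : V) : rnorm (a *: x) = rnorm a * rnorm x.
Proof. by apply: complexI; rewrite rmorphM/= -!rnormE normrZ. Qed.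

End RealNormScale.

Section Plane.
Context {R : realType}.
Implicit Types z : R[i]^o.

Lemma rnormM z w : rnorm (z * w : R[i]^o) = rnorm z * rnorm w.
Proof. exact: rnormZ. Qed.

Lemma rnormX z n : rnorm (z ^+ n : R[i]^o) = rnorm z ^+ n.
Proof.
elim: n => [|n ih]; last by rewrite !exprS rnormM ih.
by rewrite !expr0 /rnorm normr1.
Qed.

Lemma rnorm_real (r : R) : rnorm (r%:C : R[i]^o) = `|r|.
Proof. by rewrite /rnorm normc_def/= expr0n/= addr0 sqrtr_sqr. Qed.

Lemma rnorm_i : rnorm ('i%C : R[i]^o) = 1.
Proof. by rewrite /rnorm normc_def/= expr0n/= expr1n add0r sqrtr1. Qed.

Lemma sqr_rnorm z : rnorm z ^+ 2 = complex.Re z ^+ 2 + complex.Im z ^+ 2.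
Proof.
by rewrite /rnorm normc_def/= sqr_sqrtr// addr_ge0// sqr_ge0.
Qed.

Lemma complex_mk_continuous :
  continuous (fun p : R * R => (Complex p.1 p.2 : R[i]^o)).
Proof.
move=> [a b] U /nbhs_rnormP[d d0 dU].
have d2 : 0 < d / 2 by rewrite divr_gt0.
exists (ball a (d / 2), ball b (d / 2)).
  by split; exact: nbhsx_ballx.
move=> [u v] [/= au bv]; apply: dU.
rewrite (_ : _ - _ =
    ((u - a)%:C : R[i]^o) + ('i%C : R[i]^o) * (v - b)%:C); last first.
  by apply/eqP; rewrite eq_complex/=; apply/andP; split; apply/eqP; ring.
apply: le_lt_trans (ler_rnormD _ _) _.
rewrite rnormM rnorm_i mul1r !rnorm_real.
move: au bv; rewrite /ball/= => au bv.
by rewrite (distrC u) (distrC v) (splitr d) ltrD.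
Qed.

Lemma closed_disc_closed r : closed [set z : R[i]^o | rnorm z <= r].
Proof.
apply: (@preimage_closed _ _ (fun z : R[i]^o => rnorm z) [set x | x <= r]).
  by move=> z _; exact: rnorm_continuous.
exact: closed_le.
Qed.

Lemma open_disc_open r : open [set z : R[i]^o | rnorm z < r].
Proof.
apply: (@open_comp _ _ (fun z : R[i]^o => rnorm z) [set x | x < r]).
  by move=> z _; exact: rnorm_continuous.
exact: open_lt.
Qed.

Lemma closed_disc_compact r : compact [set z : R[i]^o | rnorm z <= r].
Proof.
apply: (@subclosed_compact _ _
  ((fun p : R * R => (Complex p.1 p.2 : R[i]^o)) @`
     (`[- r, r]%classic `*` `[- r, r]%classic))).
- exact: closed_disc_closed.
- apply: continuous_compact; last first.
    by apply: compact_setX; exact: segment_compact.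
  exact/continuous_subspaceT/complex_mk_continuous.
- move=> z/= zr; exists (complex.Re z, complex.Im z); last by case: z {zr}.
  have z0 := rnorm_ge0 z; have := sqr_rnorm z.
  move=> h; split => /=; rewrite in_itv/= -ler_norml.
    rewrite (le_trans _ zr)// -(@ler_pXn2r _ 2)// ?nnegrE//.
    by rewrite real_normK ?num_real// h lerDl sqr_ge0.
  rewrite (le_trans _ zr)// -(@ler_pXn2r _ 2)// ?nnegrE//.
  by rewrite real_normK ?num_real// h lerDr sqr_ge0.
Qed.

Lemma bounded_set_disc (C : set R[i]^o) : bounded_set C ->
  exists M : R, C `<=` [set z | rnorm z <= M].
Proof.
move=> [m [mR mC]]; exists (complex.Re m + 1) => z Cz /=.
have mE : m = (complex.Re m)%:C by rewrite RRe_real.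
have := mC (complex.Re m + 1)%:C; rewrite {1}mE ltcR ltrDl ltr01 => /(_ isT).
by move=> /(_ z Cz); rewrite /= rnormE lecR.
Qed.

End Plane.

(** * A maximum principle *)

Section MaximumPrinciple.
Context {R : realType}.
Implicit Types (f : R[i]^o -> R) (V : set R[i]^o) (z : R[i]^o) (r : R).

Definition cross_sum f z r : R :=
  f (z + r%:C) + f (z - r%:C) + f (z + 'i%C * r%:C) + f (z - 'i%C * r%:C).

(** Submean inequality over the four points [z + r], [z - r], [z + i r],
    [z - i r], up to an error of third order in [r]. *)
Definition cross_submean_at f z :=
  exists C d : R, 0 < d /\
    forall r, 0 < r -> r < d -> 4 * f z <= cross_sum f z r + C * r ^+ 3.

Lemma cross_sum_sqr_rnorm z r :
  cross_sum (fun w => rnorm w ^+ 2) z r = 4 * rnorm z ^+ 2 + 4 * r ^+ 2.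
Proof. by case: z => a b; rewrite /cross_sum !sqr_rnorm/=; ring. Qed.

Lemma near_cross z V : nbhs z V ->
  exists2 d : R, 0 < d & forall r, 0 < r -> r < d ->
    [/\ V (z + r%:C), V (z - r%:C), V (z + 'i%C * r%:C) &
        V (z - 'i%C * r%:C)].
Proof.
move=> /nbhs_rnormP[d d0 dV]; exists d => // r r0 rd.
by split; apply: dV; rewrite addrC addKr ?rnormN ?rnormM ?rnorm_i ?mul1r
  rnorm_real gtr0_norm.
Qed.

Lemma continuous_max f V : V !=set0 -> compact V ->
  (forall z, V z -> {for z, continuous f}) ->
  exists2 c, V c & forall z, V z -> f z <= f c.
Proof.
move=> V0 cV cf; have [|c] := compact_EVT_max V0 cV (f := f).
  apply: continuous_in_subspaceT => z; rewrite inE; exact: cf.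
by rewrite inE => Vc fc; exists c => // z Vz; apply: fc; rewrite inE.
Qed.

(** If [f] were smaller on the topological boundary than at [p], adding a small
    multiple of the squared modulus would preserve this and push the maximum
    over [V] to an interior point; but there the mean of the squared modulus
    over the four points exceeds its central value by [r ^+ 2], which beats
    the error of order [r ^+ 3]. *)
Lemma maximum_principle f V : compact V ->
  (forall z, V z -> {for z, continuous f}) ->
  (forall z, V° z -> cross_submean_at f z) ->
  forall p, V p -> exists q, [/\ V q, ~ V° q & f p <= f q].
Proof.
move=> cV cf subf p Vp; apply: contrapT => noq.
have fbd q : V q -> ~ V° q -> f q < f p.
  by move=> Vq Vq0; rewrite ltNge; apply/negP => fpq; apply: noq; exists q.
pose g (z : R[i]^o) : R := rnorm z ^+ 2.
have cg z : {for z, continuous g}.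
  rewrite (_ : g = fun w => rnorm w * rnorm w); last first.
    by apply/funext => w; rewrite /g expr2.
  by apply: continuousM; exact: rnorm_continuous.
have g_ge0 z : 0 <= g z by rewrite /g sqr_ge0.
have V0 : V !=set0 by exists p.
have [e e0 fe] : exists2 e : R, 0 < e &
    forall q, V q -> ~ V° q -> f q + e * g q < f p + e * g p.
  have [[q0 bq0]|bd0] := pselect ((V `\` V°) !=set0); last first.
    by exists 1 => // q Vq Vq0; exfalso; apply: bd0; exists q.
  have cB : compact (V `\` V°).
    apply: (subclosed_compact _ cV); last by move=> z [].
    rewrite setDE; apply: closedI.
      by apply: compact_closed cV; exact: norm_hausdorff.
    exact/open_closedC/open_interior.
  have [||q1 [Vq1 Vq1i] fq1] := @continuous_max f (V `\` V°) _ cB.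
  - by exists q0.
  - by move=> z [Vz _]; exact: cf.
  have [D VD gD] := continuous_max V0 cV (fun z _ => cg z).
  have fp := fbd _ Vq1 Vq1i.
  have D1 : 0 < g D + 1 by rewrite ltr_wpDl.
  (* [f q + e * g q <= f q1 + e * g D < f p] for this factor [e] *)
  exists ((f p - f q1) / (g D + 1)); first by rewrite divr_gt0// subr_gt0.
  move=> q Vq Vqi; set e := _ / _.
  have e0 : 0 < e by rewrite divr_gt0// subr_gt0.
  have eD : e * (g D + 1) = f p - f q1 by rewrite /e mulfVK// gt_eqF.
  have h1 := fq1 q (conj Vq Vqi); have h2 := gD q Vq.
  have h3 : e * g q <= e * g D by rewrite ler_pM2l.
  have h4 : 0 <= e * g p by rewrite mulr_ge0// ltW.
  lra.
have [m Vm mmax] : exists2 m, V m &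
    forall z, V z -> f z + e * g z <= f m + e * g m.
  apply: (continuous_max V0 cV) => z Vz; apply: continuousD; first exact: cf.
  by apply: continuousM; [exact: cst_continuous | exact: cg].
have Vmi : V° m.
  apply: contrapT => Vmi; have := fe m Vm Vmi; have := mmax p Vp.
  by move=> h1 h2; have := le_lt_trans h1 h2; rewrite ltxx.
have [C [d [d0 sub]]] := subf m Vmi.
have [d' d'0 Vd'] := near_cross Vmi.
(* the second bound makes the error [C * r ^+ 3] at most [e * r ^+ 2] *)
pose r := Num.min (Num.min d d' / 2) (e / (`|C| + 1)).
have C1 : 0 < `|C| + 1 by rewrite ltr_wpDl.
have r0 : 0 < r by rewrite !lt_min !divr_gt0// lt_min d0.
have rdd : r < Num.min d d'.
  have mdd : 0 < Num.min d d' by rewrite lt_min d0.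
  by apply: (@le_lt_trans _ _ (Num.min d d' / 2)); [rewrite ge_min lexx|lra].
have /andP[rd rd'] : (r < d) && (r < d') by rewrite -lt_min.
have rC : r * (`|C| + 1) <= e by rewrite -ler_pdivlMr// ge_min lexx orbT.
have [V1 V2 V3 V4] := Vd' r r0 rd'.
have h1 := mmax _ V1; have h2 := mmax _ V2.
have h3 := mmax _ V3; have h4 := mmax _ V4.
have := sub r r0 rd; have := cross_sum_sqr_rnorm m r.
rewrite /cross_sum -/(g _) -!/(g _) => hg hf.
have hC : C * r ^+ 3 <= e * r ^+ 2.
  rewrite exprS mulrA ler_wpM2r ?sqr_ge0// (le_trans _ rC)// mulrC.
  by rewrite ler_pM2l// (le_trans (ler_norm _))// lerDl.
have er : 0 < e * r ^+ 2 by rewrite mulr_gt0// exprn_gt0.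
have : e * (g (m + r%:C) + g (m - r%:C) + g (m + 'i%C * r%:C)
    + g (m - 'i%C * r%:C)) = e * (4 * g m + 4 * r ^+ 2) by rewrite hg.
lra.
Qed.

End MaximumPrinciple.

(** * Operator norms *)

Section OperatorNorm.
Context {R : realType} {H : normedModType R[i]}.
Implicit Types (S : H -> H) (x y : H).

Lemma bounded_operatorP S : bounded_operator S <->
  exists2 M : R, 0 <= M & forall x, rnorm (S x) <= M * rnorm x.
Proof.
have eqM (M : R) x : (`|S x| <= M%:C * `|x|) = (rnorm (S x) <= M * rnorm x).
  by rewrite !rnormE -rmorphM/= lecR.
split=> [[M SM]|[M _ SM]]; last by exists M => x; rewrite eqM.
exists `|M| => // x; have := SM x; rewrite eqM => /le_trans; apply.
by rewrite ler_wpM2r ?rnorm_ge0// ler_norm.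
Qed.

Lemma rnorm_le1 x : (`|x| <= 1) = (rnorm x <= 1).
Proof. by rewrite rnormE (lecR _ 1). Qed.

Lemma opnorm_ub S x : bounded_operator S -> rnorm x <= 1 ->
  rnorm (S x) <= opnorm S.
Proof.
move=> /bounded_operatorP[M M0 SM] x1; apply: ub_le_sup.
  exists M => _ [y /= y1 <-]; rewrite rnorm_le1 in y1.
  by apply: le_trans (SM y) _; rewrite -[leRHS]mulr1 ler_wpM2l.
by exists x => //=; rewrite rnorm_le1.
Qed.

Lemma opnorm_le S (c : R) : (forall x, rnorm x <= 1 -> rnorm (S x) <= c) ->
  opnorm S <= c.
Proof.
move=> Sc; apply: ge_sup.
  by exists (rnorm (S 0)), 0 => //=; rewrite normr0 ler01.
by move=> _ [x /= x1 <-]; apply: Sc; rewrite -rnorm_le1.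
Qed.

Lemma opnorm_ge0 S : bounded_operator S -> 0 <= opnorm S.
Proof.
move=> bS; apply: le_trans (rnorm_ge0 (S 0)) _.
by apply: opnorm_ub => //; rewrite rnorm0 ler01.
Qed.

Lemma opnorm_dist S S' (c : R) : bounded_operator S -> bounded_operator S' ->
  (forall x, rnorm x <= 1 -> rnorm (S x - S' x) <= c) ->
  `|opnorm S - opnorm S'| <= c.
Proof.
move=> bS bS' SS'; rewrite ler_norml lerBrDr lerBlDr; apply/andP; split.
  rewrite -lerBrDl opprK; apply: opnorm_le => x x1.
  rewrite -[S' x](subrK (S x)) (le_trans (ler_rnormD _ _))//.
  by rewrite rnormBC addrC lerD ?opnorm_ub ?SS'.
apply: opnorm_le => x x1.
rewrite -[S x](subrK (S' x)) (le_trans (ler_rnormD _ _))//.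
by rewrite lerD ?opnorm_ub ?SS'.
Qed.

End OperatorNorm.

(** * Expansions of operator families *)

Section Expansion.
Context {R : realType} {H : normedModType R[i]}.
Implicit Types (S : H -> H) (T U : R[i]^o -> H -> H) (z : R[i]^o) (x y : H).

Lemma linear_addE S : linear S -> {morph S : x y / x + y}.
Proof. by move=> lS x y; have := lS 1 x y; rewrite !scale1r. Qed.

Lemma linear_0E S : linear S -> S 0 = 0.
Proof. by move=> lS; apply: (addrI (S 0)); rewrite -linear_addE// !addr0. Qed.

Lemma linear_scaleE S (a : R[i]) x : linear S -> S (a *: x) = a *: S x.
Proof. by move=> lS; rewrite -[a *: x]addr0 lS linear_0E// addr0. Qed.

Lemma linear_subE S x y : linear S -> S (x - y) = S x - S y.
Proof. by move=> lS; rewrite addrC -scaleN1r lS scaleN1r addrC. Qed.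

Lemma bounded_linear_comp S S' : bounded_linear_operator S ->
  bounded_linear_operator S' -> bounded_linear_operator (S \o S').
Proof.
move=> [lS /bounded_operatorP[M M0 SM]] [lS' /bounded_operatorP[M' M'0 SM']].
split; first by move=> a x y /=; rewrite lS' lS.
apply/bounded_operatorP; exists (M * M') => [|x /=]; first exact: mulr_ge0.
by rewrite (le_trans (SM _))// -mulrA ler_wpM2l.
Qed.

Definition locally_bounded T :=
  exists2 M : R, 0 <= M &
    \forall z \near (0 : R[i]^o), forall x, rnorm (T z x) <= M * rnorm x.

Lemma locally_bounded_eq T U :
  (\forall z \near (0 : R[i]^o), T z =1 U z) ->
  locally_bounded T -> locally_bounded U.
Proof.
move=> TU [M M0 TM]; exists M => //.
by near=> z => x; rewrite -(near TU z)//; exact: (near TM).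
Unshelve. all: by end_near. Qed.

Lemma locally_boundedD T U : locally_bounded T -> locally_bounded U ->
  locally_bounded (fun z x => T z x + U z x).
Proof.
move=> [M M0 TM] [N N0 UN]; exists (M + N); first exact: addr_ge0.
near=> z => x; rewrite mulrDl (le_trans (ler_rnormD _ _))//.
by rewrite lerD//; [exact: (near TM) | exact: (near UN)].
Unshelve. all: by end_near. Qed.

Lemma locally_bounded_comp T U : locally_bounded T -> locally_bounded U ->
  locally_bounded (fun z => T z \o U z).
Proof.
move=> [M M0 TM] [N N0 UN]; exists (M * N); first exact: mulr_ge0.
near=> z => x /=; rewrite (le_trans (near TM z _ _))// -mulrA ler_wpM2l//.
exact: (near UN).
Unshelve. all: by end_near. Qed.

Lemma locally_bounded_cst S : bounded_operator S -> locally_bounded (fun=> S).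
Proof.
by move=> /bounded_operatorP[M M0 SM]; exists M => //; near=> z; exact: SM.
Unshelve. all: by end_near. Qed.

Lemma near0_disc (d : R) : 0 < d -> \forall z \near (0 : R[i]^o), rnorm z < d.
Proof. by move=> d0; apply/nbhs_rnormP; exists d => // z; rewrite subr0. Qed.

Lemma locally_boundedZ T : locally_bounded T ->
  locally_bounded (fun z x => z *: T z x).
Proof.
move=> [M M0 TM]; exists M => //; near=> z => x.
rewrite rnormZ -[leRHS]mul1r ler_pM ?rnorm_ge0//.
  by apply: ltW; near: z; exact: near0_disc.
exact: (near TM).
Unshelve. all: by end_near. Qed.

(** Families [T] of operators with a Taylor expansion at [0] of length [k],
    whose coefficients are bounded operators and whose remainder is
    [z ^+ k] times a locally bounded family. The recursive form makes the
    stability under composition an induction without any bookkeeping of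
    coefficients. *)
Fixpoint expandable (k : nat) T : Prop :=
  if k is k'.+1 then
    exists (T0 : H -> H) T', [/\ bounded_linear_operator T0, expandable k' T' &
      \forall z \near (0 : R[i]^o), forall x, T z x = T0 x + z *: T' z x]
  else locally_bounded T.

Lemma expandable_locally_bounded k T : expandable k T -> locally_bounded T.
Proof.
elim: k T => [//|k ih] T [T0 [T' [[_ bT0] /ih lT' TE]]].
apply: locally_bounded_eq (locally_boundedD (locally_bounded_cst bT0)
  (locally_boundedZ lT')).
by near=> z => x; rewrite (near TE z).
Unshelve. all: by end_near. Qed.

Lemma expandable_pred k T : expandable k.+1 T -> expandable k T.
Proof.
elim: k T => [|k ih] T; first exact: expandable_locally_bounded.
by move=> [T0 [T' [bT0 /ih eT' TE]]]; exists T0, T'.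
Qed.

Lemma bounded_linear0 : bounded_linear_operator (fun=> 0 : H).
Proof.
split; first by move=> a x y; rewrite scaler0 addr0.
by apply/bounded_operatorP; exists 0 => // x; rewrite rnorm0 mul0r.
Qed.

Lemma expandable_cst k S : bounded_linear_operator S -> expandable k (fun=> S).
Proof.
elim: k S => [|k ih] S bS; first by apply: locally_bounded_cst; case: bS.
exists S, (fun _ _ => 0); split => //; first exact/ih/bounded_linear0.
by near=> z => x; rewrite scaler0 addr0.
Unshelve. all: by end_near. Qed.

Lemma expandableD k T U : expandable k T -> expandable k U ->
  expandable k (fun z x => T z x + U z x).
Proof.
elim: k T U => [|k ih] T U; first exact: locally_boundedD.
move=> [T0 [T' [[lT0 bT0] eT' TE]]] [U0 [U' [[lU0 bU0] eU' UE]]].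
exists (fun x => T0 x + U0 x), (fun z x => T' z x + U' z x); split.
- split; first by move=> a x y; rewrite lT0 lU0 scalerDr addrACA.
  have [M M0 TM] := (bounded_operatorP T0).1 bT0.
  have [N N0 UN] := (bounded_operatorP U0).1 bU0.
  apply/bounded_operatorP; exists (M + N) => [|x]; first exact: addr_ge0.
  by rewrite mulrDl (le_trans (ler_rnormD _ _))// lerD.
- exact: ih.
- by near=> z => x; rewrite (near TE z)// (near UE z)// scalerDr addrACA.
Unshelve. all: by end_near. Qed.

(** With [T = T0 + z T'] and [U = U0 + z U'] one has
    [T U = T0 U0 + z (T0 U' + T' U)]. *)
Lemma expandable_comp k T U : expandable k T -> expandable k U ->
  expandable k (fun z => T z \o U z).
Proof.
elim: k T U => [|k ih] T U; first exact: locally_bounded_comp.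
move=> [T0 [T' [bT0 eT' TE]]] eU; have := eU.
move=> [U0 [U' [bU0 eU' UE]]].
exists (T0 \o U0), (fun z x => (T0 \o U' z) x + (T' z \o U z) x); split.
- exact: bounded_linear_comp.
- apply: expandableD; last by apply: ih => //; exact: expandable_pred.
  by apply: (ih (fun=> T0)) => //; exact: expandable_cst.
- have [lT0 _] := bT0.
  near=> z => x /=; rewrite (near TE z)// {1}(near UE z)//.
  by rewrite (linear_addE lT0) (linear_scaleE _ _ lT0) scalerDr addrA.
Unshelve. all: by end_near. Qed.

Lemma expandable_iter k T m : expandable k T ->
  expandable k (fun z => iter m (T z)).
Proof.
move=> eT; elim: m => [|m ih]; last exact: expandable_comp eT ih.
apply: (@expandable_cst k id); split => //; apply/bounded_operatorP.
by exists 1 => // x; rewrite mul1r.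
Qed.

Lemma expandable_near_bounded k T : expandable k T ->
  \forall z \near (0 : R[i]^o), bounded_operator (T z).
Proof.
move=> /expandable_locally_bounded[M M0 TM]; near=> z.
by apply/bounded_operatorP; exists M => //; near: z.
Unshelve. all: by end_near. Qed.

Lemma opnorm_continuous T z : expandable 1 (fun w => T (z + w)) ->
  {for z, continuous (fun w => opnorm (T w))}.
Proof.
move=> eT; have nb := expandable_near_bounded eT.
have [T0 [T' [_ [M M0 T'M] TE]]] := eT.
have TzE x : T z x = T0 x.
  by have := nbhs_singleton TE x; rewrite scale0r !addr0.
have bTz : bounded_operator (T z).
  by have := nbhs_singleton nb; rewrite addr0.
apply/continuous_rnormP => e e0.
suff : \forall w \near (0 : R[i]^o), `|opnorm (T z) - opnorm (T (z + w))| < e.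
  move=> /nbhs_rnormP[d d0 dP]; exists d => // w wz.
  by have := dP (w - z); rewrite subr0 (addrC z) subrK => /(_ wz).
have M1 : 0 < M + 1 by rewrite ltr_wpDl.
near=> w.
have wM : rnorm w * (M + 1) < e.
  rewrite -ltr_pdivlMr//; near: w; apply: near0_disc; exact: divr_gt0.
apply: (@le_lt_trans _ _ (rnorm w * M)); last first.
  apply: le_lt_trans wM; rewrite ler_wpM2l ?rnorm_ge0// lerDl//.
apply: opnorm_dist => //; first by near: w.
move=> x x1; rewrite TzE (near TE w)// opprD addrA subrr add0r rnormN rnormZ.
rewrite ler_wpM2l ?rnorm_ge0// (le_trans (near T'M w _ _))//.
by rewrite -[leRHS]mulr1 ler_wpM2l.
Unshelve. all: by end_near. Qed.

(** The sums over [r, -r, i r, - i r] of the first and of the second powers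
    vanish, so that averaging over the cross leaves the constant term of an
    expansion of length [3] and an error of order [r ^+ 3]. *)
Lemma opnorm_cross_submean T z : expandable 3 (fun w => T (z + w)) ->
  cross_submean_at (fun w => opnorm (T w)) z.
Proof.
move=> eT; have nb := expandable_near_bounded eT.
have [T0 [T' [_ [T1 [T'' [_ [T2 [T3 [_ [M M0 T3M] E3]]] E2]]] E1]]] := eT.
have TzE x : T z x = T0 x.
  by have := nbhs_singleton E1 x; rewrite scale0r !addr0.
have TE : \forall w \near (0 : R[i]^o), forall x,
    T (z + w) x = T0 x + w *: T1 x + w ^+ 2 *: T2 x + w ^+ 3 *: T3 w x.
  near=> w => x; rewrite (near E1 w)// (near E2 w)// (near E3 w)//.
  by rewrite !scalerDr !scalerA -!expr2 -!exprSr !addrA.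
have near4 : \forall w \near (0 : R[i]^o), [/\ bounded_operator (T (z + w)),
   forall x, rnorm (T3 w x) <= M * rnorm x & forall x,
    T (z + w) x = T0 x + w *: T1 x + w ^+ 2 *: T2 x + w ^+ 3 *: T3 w x].
  by near=> w; split; near: w.
have [d d0 dP] := near_cross near4.
exists (4 * M), d; split => // r r0 rd; have := dP r r0 rd; rewrite !add0r.
pose ws : seq R[i]^o := [:: r%:C; - r%:C; 'i%C * r%:C; - ('i%C * r%:C)].
move=> [P1 P2 P3 P4].
have Pws w : w \in ws -> [/\ bounded_operator (T (z + w)),
   forall x, rnorm (T3 w x) <= M * rnorm x & forall x,
    T (z + w) x = T0 x + w *: T1 x + w ^+ 2 *: T2 x + w ^+ 3 *: T3 w x].
  by rewrite !inE => /or4P[]/eqP ->.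
have rw w : w \in ws -> rnorm w = r.
  by rewrite !inE => /or4P[]/eqP ->; rewrite ?rnormN ?rnormM ?rnorm_i ?mul1r
    rnorm_real gtr0_norm.
have -> : cross_sum (fun w => opnorm (T w)) z r =
    \sum_(w <- ws) opnorm (T (z + w)).
  by rewrite /cross_sum !big_cons big_nil addr0 !addrA.
rewrite -ler_pdivlMl//; apply: opnorm_le => x x1; rewrite ler_pdivlMl//.
have s1 : \sum_(w <- ws) w = 0 by rewrite !big_cons big_nil; ring.
have s2 : \sum_(w <- ws) w ^+ 2 = 0.
  rewrite !big_cons big_nil sqrrN [(- ('i * _)) ^+ 2]sqrrN exprMn sqr_i.
  ring.
have -> : 4 * rnorm (T z x) = rnorm (\sum_(w <- ws) T z x).
  have -> : \sum_(w <- ws) T z x = (4%:R : R[i]^o) *: T z x.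
    by rewrite big_const_seq count_predT iter_addr_0 scaler_nat.
  rewrite rnormZ (_ : 4%:R = (4%:R : R)%:C) ?rnorm_real ?normr_nat//.
  by rewrite rmorph_nat.
have -> : \sum_(w <- ws) T z x =
    \sum_(w <- ws) (T (z + w) x - w ^+ 3 *: T3 w x).
  rewrite [RHS](eq_big_seq (fun w =>
      T z x + (w *: T1 x + w ^+ 2 *: T2 x))); last first.
    by move=> w /Pws[_ _ ->]; rewrite addrK TzE addrA.
  rewrite big_split/= -[LHS]addr0; congr (_ + _).
  by rewrite big_split/= -!scaler_suml s1 s2 !scale0r addr0.
have -> : 4 * M * r ^+ 3 = \sum_(w <- ws) M * r ^+ 3.
  by rewrite !big_cons big_nil; ring.
rewrite -big_split/=.
apply: (@le_trans _ _
  (\sum_(w <- ws) rnorm (T (z + w) x - w ^+ 3 *: T3 w x))).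
  elim: (ws) => [|w s ih]; first by rewrite !big_nil rnorm0.
  by rewrite !big_cons (le_trans (ler_rnormD _ _))// lerD2l.
rewrite big_seq [leRHS]big_seq; apply: ler_sum => w wws.
have [bT T3w _] := Pws w wws.
rewrite (le_trans (ler_rnormB _ _))// lerD//; first exact: opnorm_ub.
rewrite rnormZ rnormX rw// mulrC ler_wpM2r ?exprn_ge0 ?(ltW r0)//.
by rewrite (le_trans (T3w x))// -[leRHS]mulr1 ler_wpM2l.
Unshelve. all: by end_near. Qed.

End Expansion.

(** * Perturbation of the resolvent *)

Section Neumann.
Context {R : realType} {H : completeNormedModType R[i]}.
Variables (S : H -> H) (q : R).
Hypotheses (lS : linear S) (q_ge0 : 0 <= q) (q_lt1 : q < 1).
Hypothesis Sq : forall x, rnorm (S x) <= q * rnorm x.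

Lemma neumann_bound x : rnorm x <= rnorm (x + S x) / (1 - q).
Proof.
rewrite ler_pdivlMr ?subr_gt0//.
have := ler_rnormB (x + S x) (S x); rewrite addrK; have := Sq x; lra.
Qed.

(** [x] is the limit of the iterates of [u |-> y - S u], whose increments decay
    geometrically. *)
Lemma neumann_surjective y : exists x, x + S x = y.
Proof.
pose u := fix u n := if n is n'.+1 then y - S (u n') else 0.
have du n : rnorm (u n.+1 - u n) <= q ^+ n * rnorm y.
  elim: n => [|n ih]; first by rewrite /= (linear_0E lS) !subr0 expr0 mul1r.
  rewrite [u n.+2]/= [X in _ - X]/= opprD addrACA subrr add0r -opprD rnormN.
  rewrite -(linear_subE _ _ lS) (le_trans (Sq _))// exprS -mulrA.
  by rewrite ler_wpM2l.
have q1 : 0 < 1 - q by rewrite subr_gt0.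
have dum n m : rnorm (u (n + m)%N - u n) <= q ^+ n * (rnorm y / (1 - q)).
  suff : rnorm (u (n + m)%N - u n) <=
      q ^+ n * (rnorm y / (1 - q)) * (1 - q ^+ m).
    move=> /le_trans; apply; rewrite -[leRHS]mulr1 ler_wpM2l//.
      by rewrite !mulr_ge0 ?exprn_ge0 ?rnorm_ge0// invr_ge0 ltW.
    by rewrite lerBlDr lerDl exprn_ge0.
  elim: m => [|m ih]; first by rewrite addn0 subrr rnorm0 expr0 subrr mulr0.
  rewrite -[_ - u n](subrKA (u (n + m)%N)) addnS.
  rewrite (le_trans (ler_rnormD _ _))// (le_trans (lerD (du _) ih))//.
  rewrite exprD exprS le_eqVlt; apply/orP; left; apply/eqP; field.
  by rewrite gt_eqF.
(* [+ 1] makes the constant positive also when [y = 0] *)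
have qC0 (e : R) : 0 < e ->
    \forall n \near \oo, q ^+ n * (rnorm y / (1 - q) + 1) < e.
  move=> e0.
  have C0 : 0 < rnorm y / (1 - q) + 1.
    by rewrite ltr_wpDl// divr_ge0 ?rnorm_ge0// ltW.
  have /cvgrPdist_lt : (q ^+ n : R) @[n --> \oo] --> (0 : R).
    by apply: cvg_expr; rewrite ger0_norm.
  move=> /(_ (e / (rnorm y / (1 - q) + 1)))-/(_ (divr_gt0 e0 C0)).
  apply: filterS => n.
  by rewrite sub0r normrN ger0_norm ?exprn_ge0// ltr_pdivlMr.
have qC1 n : q ^+ n * (rnorm y / (1 - q)) <= q ^+ n * (rnorm y / (1 - q) + 1).
  by rewrite ler_wpM2l ?exprn_ge0// lerDl.
have cu : cvg (u n @[n --> \oo]).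
  apply: cauchy_cvg; apply: cauchy_exP => e e0.
  have eR : e = (complex.Re e)%:C by rewrite RRe_real// gtr0_real.
  have [|N _ NP] := qC0 (complex.Re e); first by rewrite -ltcR -eR.
  exists (u N); exists N => // n /= Nn; rewrite -ball_normE/= distrC rnormE eR.
  rewrite ltcR -(subnKC Nn) (le_lt_trans (dum _ _))//.
  by rewrite (le_lt_trans (qC1 _))// NP/=.
exists (lim (u n @[n --> \oo])); set x := lim _.
apply/subr0_eq/rnorm0_eq0/eqP; rewrite eq_le rnorm_ge0 andbT.
apply/ler_addgt0Pr => e e0; rewrite add0r.
have e3 : 0 < e / 2 by rewrite divr_gt0.
have near_x : \forall n \near \oo, rnorm (u n - x) < e / 2.
  apply: (cu [set w | rnorm (w - x) < e / 2]).
  by apply/nbhs_rnormP; exists (e / 2).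
have [N _ NP] := near_x.
have hN := NP N (leqnn N); have hN1 := NP N.+1 (leqnSn N).
rewrite (_ : _ - y = S (x - u N) - (u N.+1 - x)); last first.
  rewrite (linear_subE _ _ lS) [u N.+1]/=; move: (S (u N)) => a.
  by rewrite !opprB (addrC x (a - y)) addrA subrKA [RHS]addrAC [S x + x]addrC.
rewrite (le_trans (ler_rnormB _ _))// (splitr e) lerD// ?(ltW hN1)//.
rewrite (le_trans (Sq _))// rnormBC (le_trans _ (ltW hN))//.
by rewrite -[leRHS]mul1r ler_wpM2r ?rnorm_ge0// ltW.
Qed.

End Neumann.

Section Resolvent.
Context {R : realType} {H : completeNormedModType R[i]}.
Variables A B : linear_operator H.
Implicit Types (l z : R[i]^o) (x y : H).

Local Notation res := (pencil_inv A B).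

Lemma pencil_dom_linear (a : R[i]) x y : pencil_dom A B x ->
  pencil_dom A B y -> pencil_dom A B (a *: x + y).
Proof. by move=> [Ax Bx] [Ay By]; split; exact: dom_linear. Qed.

Lemma pencil_linear l (a : R[i]) x y : pencil_dom A B x -> pencil_dom A B y ->
  pencil A B l (a *: x + y) = a *: pencil A B l x + pencil A B l y.
Proof.
move=> [Ax Bx] [Ay By]; rewrite /pencil !opfun_linear//.
rewrite scalerDr scalerBr opprD addrACA; congr (_ - _ + _).
by rewrite !scalerA mulrC.
Qed.

Lemma pencil_shift l z x : pencil A B (l + z) x = pencil A B l x + z *: B x.
Proof. by rewrite /pencil scalerDl addrAC. Qed.

Section Bijection.
Variable l : R[i]^o.
Hypothesis bij : set_bij (pencil_dom A B) [set: H] (pencil A B l).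

Lemma pencil_inv_dom y : pencil_dom A B (res l y).
Proof. by case: (bijpinv_bij (fun=> 0) bij) => + _ _; apply. Qed.

Lemma pencil_invK y : pencil A B l (res l y) = y.
Proof.
case: bij => _ _ sur; apply: (surjpK (fun=> 0) sur); exact: in_setT.
Qed.

Lemma pencilK x : pencil_dom A B x -> res l (pencil A B l x) = x.
Proof.
by case: bij => _ inj _ Dx; apply: (pinvKV (fun=> 0) inj); rewrite inE.
Qed.

Lemma pencil_inv_linear : linear (res l).
Proof.
move=> a x y.
rewrite -[RHS]pencilK; last by apply: pencil_dom_linear; exact: pencil_inv_dom.
by rewrite pencil_linear ?pencil_invK//; exact: pencil_inv_dom.
Qed.

End Bijection.


(** With [S] the operator [B (l B - A)^-1], the pencil at [l + z] is
    [(1 + z S) (l B - A)] on its domain, and [1 + z S] is invertible as soon as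
    [z S] is a contraction. *)
Lemma resolvent_perturbation l : resolvent_set A B l ->
  bounded_operator (B \o res l) ->
  exists2 M : R, 0 <= M & \forall z \near (0 : R[i]^o),
    resolvent_set A B (l + z) /\
    forall y, rnorm (res (l + z) y) <= M * rnorm y.
Proof.
move=> [bij [lR /bounded_operatorP[N N0 RN]]] /bounded_operatorP[M M0 SM].
have domR y : pencil_dom A B (res l y) := pencil_inv_dom bij y.
exists (N * 2) => [|]; first by rewrite mulr_ge0.
have M1 : 0 < M + 1 by rewrite ltr_wpDl.
near=> z.
have zM : rnorm z * M <= 1 / 2.
  have : rnorm z < 1 / 2 / (M + 1).
    by near: z; apply: near0_disc; rewrite !divr_gt0.
  rewrite ltr_pdivlMr// => /ltW; apply: le_trans.
  by rewrite ler_wpM2l ?rnorm_ge0// lerDl.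
pose S y := z *: B (res l y).
have lS : linear S.
  move=> a x y; rewrite /S lR opfun_linear; last 2 first.
  - by case: (domR x).
  - by case: (domR y).
  by rewrite scalerDr !scalerA mulrC.
have half1 : 1 / 2 < 1 :> R by lra.
have half0 : 0 <= 1 / 2 :> R by lra.
have Sq x : rnorm (S x) <= 1 / 2 * rnorm x.
  rewrite rnormZ (le_trans (ler_wpM2l (rnorm_ge0 _) (SM x)))// mulrA.
  by rewrite ler_wpM2r ?rnorm_ge0.
have Sbound x : rnorm x <= 2 * rnorm (x + S x).
  have := neumann_bound half1 Sq x; rewrite ler_pdivlMr; lra.
have pencilR y : pencil A B (l + z) (res l y) = y + S y.
  by rewrite pencil_shift (pencil_invK bij).
have bijz : set_bij (pencil_dom A B) [set: H] (pencil A B (l + z)).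
  split => //.
    move=> x x'; rewrite !inE => Dx Dx'.
    rewrite -(pencilK bij Dx) -(pencilK bij Dx') !pencilR.
    set v := pencil A B l x; set v' := pencil A B l x' => vv'.
    congr (res l _); apply/subr0_eq/rnorm0_eq0/eqP.
    rewrite eq_le rnorm_ge0 andbT (le_trans (Sbound _))//.
    by rewrite (linear_subE _ _ lS) addrACA -opprD vv' subrr rnorm0 mulr0.
  move=> y _; have [x xy] := neumann_surjective lS half0 half1 Sq y.
  by exists (res l x) => //; rewrite pencilR.
have bound y : rnorm (res (l + z) y) <= N * 2 * rnorm y.
  have Dy := pencil_inv_dom bijz y.
  rewrite -{1}(pencilK bij Dy) (le_trans (RN _))// -mulrA ler_wpM2l//.
  rewrite (le_trans (Sbound _))// -pencilR (pencilK bij Dy).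
  by rewrite (pencil_invK bijz).
split => //; split => //; split; first exact: pencil_inv_linear.
by apply/bounded_operatorP; exists (N * 2) => //; rewrite mulr_ge0.
Unshelve. all: by end_near. Qed.

Lemma near_resolvent_set l : resolvent_set A B l ->
  bounded_operator (B \o res l) ->
  \forall z \near (0 : R[i]^o), resolvent_set A B (l + z).
Proof.
move=> rl bS; have [M _ RM] := resolvent_perturbation rl bS.
by near=> z; have [] := near RM z.
Unshelve. all: by end_near. Qed.

Lemma resolvent_locally_bounded l : resolvent_set A B l ->
  bounded_operator (B \o res l) -> locally_bounded (fun z => res (l + z)).
Proof.
move=> rl bS; have [M M0 RM] := resolvent_perturbation rl bS.
by exists M => //; near=> z; have [] := near RM z.
Unshelve. all: by end_near. Qed.

Lemma resolvent_equation l z y : resolvent_set A B l ->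
  resolvent_set A B (l + z) ->
  res (l + z) y = res l y - z *: res (l + z) (B (res l y)).
Proof.
move=> [bij _] [bijz [lz _]].
have := pencilK bijz (pencil_inv_dom bij y).
by rewrite pencil_shift (pencil_invK bij) (linear_addE lz)
  (linear_scaleE _ _ lz) => {1}<-; rewrite addrK.
Qed.

(** The resolvent equation [R(l + z) = R(l) - z R(l + z) B R(l)] bootstraps
    local boundedness into expansions of any length. *)
Lemma resolvent_expandable k l : resolvent_set A B l ->
  bounded_operator (B \o res l) -> expandable k (fun z => res (l + z)).
Proof.
move=> rl bS; have blS : bounded_linear_operator (fun y => - B (res l y)).
  case: rl => bij [lR _]; split.
    move=> a x y; rewrite lR opfun_linear.
    - by rewrite opprD scalerN.
    - by case: (pencil_inv_dom bij x).
    - by case: (pencil_inv_dom bij y).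
  have [M M0 SM] := (bounded_operatorP _).1 bS.
  by apply/bounded_operatorP; exists M => // y; rewrite rnormN; exact: SM.
elim: k => [|k ih]; first exact: resolvent_locally_bounded.
exists (res l), (fun z => res (l + z) \o (fun y => - B (res l y))); split.
- by case: rl.
- by apply: expandable_comp => //; exact: expandable_cst.
- near=> z => y /=; have rz : resolvent_set A B (l + z).
    by near: z; exact: near_resolvent_set.
  rewrite resolvent_equation//; case: rz => _ [lz _].
  by rewrite -[- B _]scaleN1r (linear_scaleE _ _ lz) scaleN1r scalerN.
Unshelve. all: by end_near. Qed.

End Resolvent.

(** * Pseudospectra *)

Section Pseudospectrum.
Context {R : realType} {H : completeNormedModType R[i]}.
Variables (A B : linear_operator H) (n : nat) (eps : R).
Hypothesis eps_gt0 : 0 < eps.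
Hypothesis B_res : forall l : R[i]^o, resolvent_set A B l ->
  bounded_operator (B \o pencil_inv A B l).

Let resolvent_norm (l : R[i]^o) : R :=
  opnorm (iter (2 ^ n)%N (pencil_inv A B l)).

Lemma iter_resolvent_expandable k l : resolvent_set A B l ->
  expandable k (fun z => iter (2 ^ n)%N (pencil_inv A B (l + z))).
Proof.
move=> rl; apply: expandable_iter.
by apply: resolvent_expandable => //; exact: B_res.
Qed.

Lemma resolvent_norm_continuous l : resolvent_set A B l ->
  {for l, continuous resolvent_norm}.
Proof.
move=> rl; apply: (@opnorm_continuous _ _
  (fun w => iter (2 ^ n)%N (pencil_inv A B w))).
exact: iter_resolvent_expandable.
Qed.

Lemma resolvent_norm_submean l : resolvent_set A B l ->
  cross_submean_at resolvent_norm l.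
Proof.
move=> rl; apply: (@opnorm_cross_submean _ _
  (fun w => iter (2 ^ n)%N (pencil_inv A B w))).
exact: iter_resolvent_expandable.
Qed.

Lemma resolvent_norm_ge0 l : resolvent_set A B l -> 0 <= resolvent_norm l.
Proof.
move=> rl; apply: opnorm_ge0.
have := expandable_near_bounded (iter_resolvent_expandable 0 rl).
move=> /nbhs_singleton.
by rewrite addr0.
Qed.

Lemma ge_rootE (x : R) : 0 <= x ->
  (eps^-1 <= x `^ ((2 ^ n)%N%:R)^-1) = (eps^-1 ^+ (2 ^ n) <= x).
Proof.
move=> x0; have m0 : (0 : R) < (2 ^ n)%N%:R by rewrite ltr0n expn_gt0.
have e0 : 0 <= eps^-1 by rewrite invr_ge0 ltW.
rewrite -[in RHS](powR_mulrn _ e0) -(@ler_pXn2r _ (2 ^ n)) ?expn_gt0//.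
- rewrite -!powR_mulrn ?powR_ge0// -powRrM mulVf ?gt_eqF// powRr1//.
- by rewrite nnegrE powR_ge0.
Qed.

Lemma pseudospectrumE l : resolvent_set A B l ->
  pseudospectrum n eps A B l <-> eps^-1 ^+ (2 ^ n) <= resolvent_norm l.
Proof.
move=> rl; rewrite -ge_rootE; last exact: resolvent_norm_ge0.
by split => [[|]//|]; right.
Qed.

Lemma resolvent_set_open : open (resolvent_set A B).
Proof.
rewrite openE => l rl; apply/nbhs_rnormP.
have /nbhs_rnormP[d d0 dP] := near_resolvent_set rl (B_res rl).
exists d => // w wl; have := dP (w - l); rewrite subr0 (addrC l) subrK.
exact.
Qed.

Lemma pseudospectrum_closed : closed (pseudospectrum n eps A B).
Proof.
rewrite -openC openE => l lP.
have rl : resolvent_set A B l by apply: contrapT => nl; apply: lP; left.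
have fl : resolvent_norm l < eps^-1 ^+ (2 ^ n).
  by rewrite ltNge; apply/negP => /(pseudospectrumE rl).
have gap : 0 < eps^-1 ^+ (2 ^ n) - resolvent_norm l by rewrite subr_gt0.
have [d d0 dP] :=
  (continuous_rnormP _ _).1 (resolvent_norm_continuous rl) _ gap.
have /nbhs_rnormP[d' d'0 d'P] := open_nbhs_nbhs (conj resolvent_set_open rl).
apply/nbhs_rnormP; exists (Num.min d d'); first by rewrite lt_min d0.
move=> w; rewrite lt_min => /andP[wd wd'].
have rw := d'P w wd'; move=> /(pseudospectrumE rw).
apply/negP; rewrite -ltNge; have := dP w wd.
by rewrite ltr_norml => /andP[h _]; lra.
Qed.

(** If a bounded component avoided the spectrum, a clopen part [N] of a bounded
    piece of the pseudospectrum would separate it from the spectrum. Then [l]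
    would have a compact neighbourhood [V], inside the resolvent set, whose
    boundary avoids the pseudospectrum: the norm would be smaller on the
    boundary than at [l], against the maximum principle. *)
Lemma component_meets_spectrum l : pseudospectrum n eps A B l ->
  let C := connected_component (pseudospectrum n eps A B) l in
  bounded_set C -> C `&` spectrum A B !=set0.
Proof.
move=> Pl C /bounded_set_disc[M CM]; apply: contrapT => CS.
have Cres : C `<=` resolvent_set A B.
  by move=> w Cw; apply: contrapT => nw; apply: CS; exists w.
pose disc (r : R) := [set w : R[i]^o | rnorm w <= r].
pose odisc (r : R) := [set w : R[i]^o | rnorm w < r].
have hC : hausdorff_space R[i]^o by exact: norm_hausdorff.
have cL : compact (disc (M + 2)) by exact: closed_disc_compact.
have discL : disc (M + 1) `<=` (disc (M + 2))°.
  have oo : open (odisc (M + 2)) by exact: open_disc_open.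
  move=> w wM; apply: (@filterS _ _ _ (odisc (M + 2))); first by move=> v /ltW.
  by apply: open_nbhs_nbhs; split => //; move: wM; rewrite /odisc /disc/=; lra.
(* the bound [M + 1] exceeds [M], so that [C] lies in the open disc, where
   being open in [K] and in the pseudospectrum agree *)
pose K := pseudospectrum n eps A B `&` disc (M + 1).
have clK : closed K.
  apply: closedI; [exact: pseudospectrum_closed | exact: closed_disc_closed].
have KL : K `<=` (disc (M + 2))° by move=> w [_ /discL].
have Cl : C l by exact: connected_component_refl.
have Kl : K l by split => //; have := CM _ Cl; rewrite /disc/=; lra.
pose W := resolvent_set A B `&` odisc (M + 1).
have oW : open W.
  by apply: openI; [exact: resolvent_set_open | exact: open_disc_open].
have CW : connected_component K l `<=` W.
  move=> w Kw; suff Cw : C w.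
    by split; [exact: Cres | have := CM _ Cw; rewrite /odisc/=; lra].
  apply: connected_component_max Kw.
  - exact: connected_component_refl.
  - exact: subset_trans (@connected_component_sub _ _ _) (@subIsetl _ _ _).
  - exact: component_connected.
have [N [[clN clKN NK] Nl NW]] := component_clopen_nbhs hC cL clK KL Kl oW CW.
(* within [G] the pseudospectrum reduces to [N] *)
pose G := W `&` ~` (K `\` N).
have oG : open G by apply: openI => //; exact: closed_openC.
have NG : N `<=` G by move=> w Nw; split; [exact: NW | move=> []].
have [U [oU NU UG]] :=
  closed_sub_open_shrink hC cL clN (subset_trans NK KL) oG NG.
pose V := closure U.
have cV : compact V.
  apply: (subclosed_compact _ cL); first exact: closed_closure.
  move=> w /UG [[_ wM] _]; move: wM; rewrite /odisc /disc/=; lra.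
have UV : U `<=` V° by rewrite -open_subsetE//; exact: subset_closure.
have Vres : V `<=` resolvent_set A B by move=> w /UG[[]].
have Vl : V l by apply: subset_closure; exact: NU.
have [||q [Vq Vqi flq]] := @maximum_principle _ resolvent_norm V cV _ _ l Vl.
- by move=> w Vw; exact/resolvent_norm_continuous/Vres.
- move=> w Vw; apply/resolvent_norm_submean/Vres; exact: interior_subset Vw.
apply: Vqi; apply: UV; apply: NU; apply: contrapT => nNq.
have [[rq qM] nKN] := UG _ Vq; apply: nKN; split; last exact: nNq.
split; last exact: ltW qM.
apply/(pseudospectrumE rq); apply: le_trans flq.
exact/(pseudospectrumE (Vres _ Vl)).
Qed.

End Pseudospectrum.

Unset Implicit Arguments.

Theorem theorem2p8 (R : realType) (H : completeNormedModType R[i])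
    (ip : {dot H for @Num.conj R[i]})
    (ip_norm : forall x : H, ip x x = `|x| ^+ 2)
    (A B : linear_operator H)
    (A_closed : closed_operator A) (B_closed : closed_operator B)
    (n : nat) (eps : R) (eps_gt0 : 0 < eps)
    (B_res_bounded : forall lambda : R[i], resolvent_set A B lambda ->
      bounded_operator (B \o pencil_inv A B lambda)) :
  closed (pseudospectrum n eps A B) /\
  (forall lambda : R[i], pseudospectrum n eps A B lambda ->
    let C := connected_component (pseudospectrum n eps A B) lambda in
    bounded_set C -> C `&` spectrum A B !=set0).
Proof.
split; first exact: pseudospectrum_closed.
by move=> l; exact: component_meets_spectrum.
Qed.
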